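(* Let $p$ and $q$ be finite-state CCS processes. Then $p\approx^c q$ if and only if $p+r\approx q+r$ for all CCS processes $r$.
   Context: Processes. Let $\alpha$ and $\beta$ be nonempty sets. Labels are $\mathrm{name}(b)$ and $\mathrm{coname}(b)$ for $b\in\beta$; the complement $\overline{\cdot}$ exchanges $\mathrm{name}(b)$ and $\mathrm{coname}(b)$. Actions are $\tau$ and the labels. CCS processes are the terms freely generated by: $\mathrm{nil}$; variables (constants) $X\in\alpha$; $u.E$ ($u$ an action); $E+E'$; $E\,||\,E'$; $\nu L\,E$ ($L$ a set of labels); $\mathrm{relab}(E,f)$ ($f$ a function from labels to labels commuting with complement, extended to actions by $f(\tau)=\tau$); $\mathrm{rec}\,X.E$. The transition relation $E\xrightarrow{u}E'$ is the least relation such that: $u.E\xrightarrow{u}E$; if $E\xrightarrow{u}E_1$ then $E+E'\xrightarrow{u}E_1$ and $E'+E\xrightarrow{u}E_1$; if $E\xrightarrow{u}E_1$ then $E||E'\xrightarrow{u}E_1||E'$ and $E'||E\xrightarrow{u}E'||E_1$; if $E\xrightarrow{l}E_1$ and $E'\xrightarrow{\overline{l}}E_2$ for a label $l$ then $E||E'\xrightarrow{\tau}E_1||E_2$; if $E\xrightarrow{u}E_1$ and either $u=\tau$ or $u$ is a label with $u,\overline{u}\notin L$, then $\nu L\,E\xrightarrow{u}\nu L\,E_1$; if $E\xrightarrow{u}E_1$ then $\mathrm{relab}(E,f)\xrightarrow{f(u)}\mathrm{relab}(E_1,f)$; if $E\{\mathrm{rec}\,X.E/X\}\xrightarrow{u}E_1$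 then $\mathrm{rec}\,X.E\xrightarrow{u}E_1$ (the substitution replaces the occurrences of $X$ not under a binder $\mathrm{rec}\,X$). Weak notions. $E\overset{\epsilon}{\Rightarrow}E'$ is the reflexive transitive closure of $\xrightarrow{\tau}$. For any action $u$ (including $\tau$), $E\overset{u}{\Rightarrow}E'$ means there are $E_1,E_2$ with $E\overset{\epsilon}{\Rightarrow}E_1\xrightarrow{u}E_2\overset{\epsilon}{\Rightarrow}E'$. A relation $W$ on processes is a weak bisimulation if whenever $W\,E\,E'$: for each label $l$, $E\xrightarrow{l}E_1$ implies there is $E_2$ with $E'\overset{l}{\Rightarrow}E_2$ and $W\,E_1\,E_2$, and $E'\xrightarrow{l}E_2$ implies there is $E_1$ with $E\overset{l}{\Rightarrow}E_1$ and $W\,E_1\,E_2$; and $E\xrightarrow{\tau}E_1$ implies there is $E_2$ with $E'\overset{\epsilon}{\Rightarrow}E_2$ and $W\,E_1\,E_2$, and $E'\xrightarrow{\tau}E_2$ implies there is $E_1$ with $E\overset{\epsilon}{\Rightarrow}E_1$ and $W\,E_1\,E_2$. Weak equivalence: $E\approx E'$ iff $W\,E\,E'$ for some weak bisimulation $W$. Observation congruence: $E\approx^c E'$ iff for every action $u$ (including $\tau$): for every $E_1$ with $E\xrightarrow{u}E_1$ there is $E_2$ with $E'\overset{u}{\Rightarrow}E_2$ and $E_1\approx E_2$; and for every $E_2$ with $E'\xrightarrow{u}E_2$ there is $E_1$ with $E\overset{u}{\Rightarrow}E_1$ and $E_1\approx E_2$. Finite-state: reachability is the reflexive transitive closure of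 the relation ''$E\xrightarrow{u}E'$ for some action $u$''; $p$ is finite-state if the set of processes reachable from $p$ is finite. *)

(* Defs.v *)
From Stdlib Require Export Relations Ensembles Finite_sets ClassicalEpsilon.

Set Implicit Arguments.

Inductive label (beta : Type) : Type :=
| name (b : beta)
| coname (b : beta).

Definition compl (beta : Type) (l : label beta) : label beta :=
  match l with
  | name b => coname b
  | coname b => name b
  end.

Inductive action (beta : Type) : Type :=
| tau
| act (l : label beta).

Arguments tau {beta}.

Record relabeling (beta : Type) : Type := Relabeling {
  relabel :> label beta -> label beta;
  relabel_compl : forall l, relabel (compl l) = compl (relabel l)
}.

Definition relabel_action (beta : Type) (f : relabeling beta)
    (u : action beta) : action beta :=
  match u with
  | tau => tau
  | act l => act (f l)
  end.

Inductive process (alpha beta : Type) : Type :=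
| nil
| var (X : alpha)
| prefix (u : action beta) (E : process alpha beta)
| sum (E E' : process alpha beta)
| par (E E' : process alpha beta)
| nu (L : Ensemble (label beta)) (E : process alpha beta)
| relab (E : process alpha beta) (f : relabeling beta)
| rec (X : alpha) (E : process alpha beta).

Arguments nil {alpha beta}.
Arguments var {alpha beta} X.

(* [subst X F E] is E{F/X}.  Only the occurrences of [X] under a binder
   [rec X] are protected: bound variables are not renamed, so free variables
   of [F] may be captured.  Equality on [alpha] is decided classically. *)
Fixpoint subst (alpha beta : Type) (X : alpha) (F E : process alpha beta)
    : process alpha beta :=
  match E with
  | nil => nil
  | var Y => if excluded_middle_informative (Y = X) then F else var Y
  | prefix u E1 => prefix u (subst X F E1)
  | sum E1 E2 => sum (subst X F E1) (subst X F E2)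
  | par E1 E2 => par (subst X F E1) (subst X F E2)
  | nu L E1 => nu L (subst X F E1)
  | relab E1 f => relab (subst X F E1) f
  | rec Y E1 =>
      if excluded_middle_informative (Y = X) then rec Y E1
      else rec Y (subst X F E1)
  end.

Inductive trans (alpha beta : Type) :
    process alpha beta -> action beta -> process alpha beta -> Prop :=
| trans_prefix u E : trans (prefix u E) u E
| trans_sum_l E E' u E1 : trans E u E1 -> trans (sum E E') u E1
| trans_sum_r E E' u E1 : trans E u E1 -> trans (sum E' E) u E1
| trans_par_l E E' u E1 : trans E u E1 -> trans (par E E') u (par E1 E')
| trans_par_r E E' u E1 : trans E u E1 -> trans (par E' E) u (par E' E1)
| trans_par_com E E' l E1 E2 :
    trans E (act l) E1 -> trans E' (act (compl l)) E2 ->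
    trans (par E E') tau (par E1 E2)
| trans_nu_tau L E E1 : trans E tau E1 -> trans (nu L E) tau (nu L E1)
| trans_nu_label L E l E1 :
    trans E (act l) E1 -> ~ In _ L l -> ~ In _ L (compl l) ->
    trans (nu L E) (act l) (nu L E1)
| trans_relab E f u E1 :
    trans E u E1 -> trans (relab E f) (relabel_action f u) (relab E1 f)
| trans_rec X E u E1 :
    trans (subst X (rec X E) E) u E1 -> trans (rec X E) u E1.

Definition eps (alpha beta : Type) : relation (process alpha beta) :=
  clos_refl_trans _ (fun E E' => trans E tau E').

Definition weak_trans (alpha beta : Type) (E : process alpha beta)
    (u : action beta) (E' : process alpha beta) : Prop :=
  exists E1 E2, eps E E1 /\ trans E1 u E2 /\ eps E2 E'.

Definition weak_bisim (alpha beta : Type)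
    (W : relation (process alpha beta)) : Prop :=
  forall E E', W E E' ->
    (forall l,
       (forall E1, trans E (act l) E1 ->
          exists E2, weak_trans E' (act l) E2 /\ W E1 E2) /\
       (forall E2, trans E' (act l) E2 ->
          exists E1, weak_trans E (act l) E1 /\ W E1 E2)) /\
    (forall E1, trans E tau E1 -> exists E2, eps E' E2 /\ W E1 E2) /\
    (forall E2, trans E' tau E2 -> exists E1, eps E E1 /\ W E1 E2).

Definition weak_equiv (alpha beta : Type) (E E' : process alpha beta) : Prop :=
  exists W, weak_bisim W /\ W E E'.

Definition obs_congr (alpha beta : Type) (E E' : process alpha beta) : Prop :=
  forall u,
    (forall E1, trans E u E1 ->
       exists E2, weak_trans E' u E2 /\ weak_equiv E1 E2) /\
    (forall E2, trans E' u E2 ->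
       exists E1, weak_trans E u E1 /\ weak_equiv E1 E2).

Definition reach (alpha beta : Type) : relation (process alpha beta) :=
  clos_refl_trans _ (fun E E' => exists u, trans E u E').

Definition finite_state (alpha beta : Type) (p : process alpha beta) : Prop :=
  Finite _ (reach p).

(* Main.v *)
(* Van Glabbeek's argument with Klop's processes: k 0 = nil,
   k (n+1) = k n + a.(k n).  They have no tau-transition and are pairwise not
   weakly equivalent, so some k n is not weakly equivalent to any state reachable
   from p or q.  With r = a.(k n), a move of p in p + r can then only be answered
   by a move of q: answering p -tau-> p' by idling would make the state p' of p
   weakly equivalent to q + a.(k n), which reaches k n by a, and answering
   p -a-> p' by the summand a.(k n) would make p' weakly equivalent to k n. *)
Require Import Defs.
From Stdlib Require Import Arith Lia.

(** * Weak simulations, and weak equivalence as an equivalence relation *)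

(** The answers allowed in a weak bisimulation: a [tau] move may be matched by idling. Treating all
    actions at once turns the four clauses of [weak_bisim] into one simulation condition on [W] and
    on its converse. *)
Definition hat_trans {alpha beta : Type} (E : process alpha beta)
    (u : action beta) (E' : process alpha beta) : Prop :=
  match u with
  | tau => eps E E'
  | act _ => weak_trans E u E'
  end.

Definition weak_sim {alpha beta : Type}
    (W : relation (process alpha beta)) : Prop :=
  forall E E' u E1, W E E' -> trans E u E1 ->
    exists E2, hat_trans E' u E2 /\ W E1 E2.

Lemma weak_bisim_sim {alpha beta : Type} (W : relation (process alpha beta)) :
  weak_bisim W <-> weak_sim W /\ weak_sim (transp _ W).
Proof.
  split.
  - intros HW; split; intros E E' [|l] E1 HE Htr.
    + destruct (HW _ _ HE) as (_ & H & _); exact (H _ Htr).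
    + destruct (HW _ _ HE) as (H & _); exact (proj1 (H l) _ Htr).
    + destruct (HW _ _ HE) as (_ & _ & H); exact (H _ Htr).
    + destruct (HW _ _ HE) as (H & _); exact (proj2 (H l) _ Htr).
  - intros [H1 H2] E E' HE; repeat split.
    + intros E1; exact (H1 _ _ _ E1 HE).
    + intros E2; exact (H2 _ _ (act l) E2 HE).
    + intros E1; exact (H1 _ _ _ E1 HE).
    + intros E2; exact (H2 _ _ tau E2 HE).
Qed.

Lemma eps_weak_trans {alpha beta : Type} (E F G H : process alpha beta) u :
  eps E F -> weak_trans F u G -> eps G H -> weak_trans E u H.
Proof.
  intros HEF (F1 & F2 & HF & Htr & HG) HGH.
  exists F1, F2; repeat split; trivial; eapply rt_trans; eassumption.
Qed.

Lemma trans_weak_trans {alpha beta : Type} (E E1 : process alpha beta) u :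
  trans E u E1 -> weak_trans E u E1.
Proof. intros H; exists E, E1; repeat split; trivial; apply rt_refl. Qed.

Lemma trans_eps {alpha beta : Type} (E E1 : process alpha beta) :
  trans E tau E1 -> eps E E1.
Proof. intros H; apply rt_step, H. Qed.

Lemma weak_trans_hat {alpha beta : Type} (E E1 : process alpha beta) u :
  weak_trans E u E1 -> hat_trans E u E1.
Proof.
  destruct u as [|l]; trivial.
  intros (F1 & F2 & H1 & H2 & H3).
  eapply rt_trans; [exact H1|]; eapply rt_trans; [apply trans_eps, H2|exact H3].
Qed.

Lemma weak_trans_eps_cons {alpha beta : Type} (E F G : process alpha beta) u :
  trans E u F -> eps F G -> weak_trans E u G.
Proof.
  intros H1 H2; eapply eps_weak_trans;
    [apply rt_refl | apply trans_weak_trans, H1 | exact H2].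
Qed.

Lemma weak_sim_eps {alpha beta : Type} (W : relation (process alpha beta))
    (HW : weak_sim W) E E' E1 :
  W E E' -> eps E E1 -> exists E2, eps E' E2 /\ W E1 E2.
Proof.
  intros HE Heps; revert E' HE.
  induction Heps as [E F Htr | E | E F G _ IH1 _ IH2]; intros E' HE.
  - exact (HW _ _ _ _ HE Htr).
  - exists E'; split; trivial; apply rt_refl.
  - destruct (IH1 _ HE) as (F' & HF' & HF).
    destruct (IH2 _ HF) as (G' & HG' & HG).
    exists G'; split; trivial; eapply rt_trans; eassumption.
Qed.

Lemma weak_sim_hat {alpha beta : Type} (W : relation (process alpha beta))
    (HW : weak_sim W) E E' u E1 :
  W E E' -> hat_trans E u E1 -> exists E2, hat_trans E' u E2 /\ W E1 E2.
Proof.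
  destruct u as [|l]; [now apply weak_sim_eps|].
  intros HE (F & G & HEF & Htr & HGE1).
  destruct (weak_sim_eps _ HW _ _ _ HE HEF) as (F' & HF' & HF).
  destruct (HW _ _ _ _ HF Htr) as (G' & HG' & HG).
  destruct (weak_sim_eps _ HW _ _ _ HG HGE1) as (E2 & HE2 & HE1).
  exists E2; split; trivial; eapply eps_weak_trans; eassumption.
Qed.

Lemma weak_equiv_sim {alpha beta : Type} : weak_sim (@weak_equiv alpha beta).
Proof.
  intros E E' u E1 (W & HW & HE) Htr.
  destruct (proj1 (proj1 (weak_bisim_sim W) HW) _ _ _ _ HE Htr)
    as (E2 & H2 & H).
  exists E2; split; trivial; exists W; auto.
Qed.

Lemma weak_equiv_refl {alpha beta : Type} (E : process alpha beta) :
  weak_equiv E E.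
Proof.
  exists eq; split; trivial.
  apply weak_bisim_sim; split; intros F F' u F1 HF Htr; hnf in HF; subst F';
    exists F1; (split; [|reflexivity]);
    apply weak_trans_hat, trans_weak_trans, Htr.
Qed.

Lemma weak_equiv_sym {alpha beta : Type} (E E' : process alpha beta) :
  weak_equiv E E' -> weak_equiv E' E.
Proof.
  intros (W & HW & HE); exists (transp _ W); split; trivial.
  apply weak_bisim_sim in HW; destruct HW.
  apply weak_bisim_sim; split; trivial.
Qed.

(** The answer given by [V] is a whole weak move, so [W] has to follow it through [weak_sim_hat]. *)
Lemma weak_sim_comp {alpha beta : Type} (V W : relation (process alpha beta)) :
  weak_sim V -> weak_sim W -> weak_sim (fun E G => exists F, V E F /\ W F G).
Proof.
  intros HV HW E G u E1 (F & HEF & HFG) Htr.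
  destruct (HV _ _ _ _ HEF Htr) as (F1 & HF1 & HEF1).
  destruct (weak_sim_hat _ HW _ _ _ _ HFG HF1) as (G1 & HG1 & HFG1).
  exists G1; split; trivial; exists F1; auto.
Qed.

Lemma weak_equiv_trans {alpha beta : Type} (E F G : process alpha beta) :
  weak_equiv E F -> weak_equiv F G -> weak_equiv E G.
Proof.
  intros HEF HFG.
  exists (fun E G => exists F, weak_equiv E F /\ weak_equiv F G).
  split; [|now exists F].
  apply weak_bisim_sim; split.
  - apply weak_sim_comp; exact weak_equiv_sim.
  (* By symmetry of [weak_equiv], the converse of the composite is the composite itself. *)
  - intros A B u A1 (C & HBC & HCA) Htr.
    destruct (weak_sim_comp _ _ weak_equiv_sim weak_equiv_sim A B u A1)
      as (B1 & HB1 & C1 & HC1 & HC2); trivial.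
    + exists C; split; now apply weak_equiv_sym.
    + exists B1; split; trivial; exists C1; split; now apply weak_equiv_sym.
Qed.

(** * Observation congruence is preserved by sums *)

(** A weak move contains at least one real step, and the first one resolves the choice in favour of
    [E]. The analogue for [eps] fails, since an empty sequence leaves the summand [F] in place. *)
Lemma weak_trans_sum_l {alpha beta : Type} (E F E1 : process alpha beta) u :
  weak_trans E u E1 -> weak_trans (sum E F) u E1.
Proof.
  intros (G & G1 & HEG & Htr & Heps).
  apply clos_rt_rt1n in HEG; destruct HEG as [|H G Hstep HHG].
  - eapply weak_trans_eps_cons; [apply trans_sum_l, Htr | exact Heps].
  - exists G, G1; repeat split; trivial.
    eapply rt_trans; [apply trans_eps, trans_sum_l, Hstep|].
    apply clos_rt1n_rt, HHG.
Qed.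

Lemma obs_congr_sym {alpha beta : Type} (p q : process alpha beta) :
  obs_congr p q -> obs_congr q p.
Proof.
  intros H u; split; intros E1 Htr; [apply (proj2 (H u)) in Htr
    | apply (proj1 (H u)) in Htr]; destruct Htr as (E2 & H2 & H1);
    exists E2; split; trivial; now apply weak_equiv_sym.
Qed.

Lemma obs_congr_weak_equiv_sum {alpha beta : Type} (p q r : process alpha beta) :
  obs_congr p q -> weak_equiv (sum p r) (sum q r).
Proof.
  intros Hpq.
  (* One step from a pair of sums leads into [weak_equiv]. Quantifying over [p] and [q] inside makes
     the relation symmetric, so that one simulation suffices. *)
  exists (fun A B => weak_equiv A B
    \/ exists p q, obs_congr p q /\ A = sum p r /\ B = sum q r).
  split; [|right; now exists p, q]; clear p q Hpq.
  assert (Hsim : weak_sim (fun A B => weak_equiv A B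
    \/ exists p q, obs_congr p q /\ A = sum p r /\ B = sum q r)).
  { intros A B u A1 [HAB | (p & q & Hpq & -> & ->)] Htr.
    - destruct (weak_equiv_sim _ _ _ _ HAB Htr) as (B1 & HB1 & H1).
      exists B1; auto.
    - inversion Htr as [|? ? ? ? Hp|? ? ? ? Hr| | | | | | |]; subst.
      + destruct (proj1 (Hpq u) _ Hp) as (q1 & Hq1 & H1).
        exists q1; split; auto; now apply weak_trans_hat, weak_trans_sum_l.
      + exists A1; split; [|left; apply weak_equiv_refl].
        now apply weak_trans_hat, trans_weak_trans, trans_sum_r. }
  apply weak_bisim_sim; split; trivial.
  intros A B u A1 HAB Htr.
  destruct (Hsim A B u A1) as (B1 & HB1 & H1); trivial.
  - destruct HAB as [HAB | (p & q & Hpq & -> & ->)];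
      [left; now apply weak_equiv_sym | right].
    exists q, p; auto using obs_congr_sym.
  - exists B1; split; trivial.
    destruct H1 as [H1 | (p & q & Hpq & -> & ->)];
      [left; now apply weak_equiv_sym | right].
    exists q, p; auto using obs_congr_sym.
Qed.

(** * Klop's processes and their inequivalence *)

Fixpoint klop (alpha : Type) {beta : Type} (a : label beta) (n : nat)
    : process alpha beta :=
  match n with
  | 0 => nil
  | S n => sum (klop alpha a n) (prefix (act a) (klop alpha a n))
  end.

Lemma klop_trans {alpha beta : Type} (a : label beta) n u (E : process alpha beta) :
  trans (klop alpha a n) u E ->
  u = act a /\ exists m, m < n /\ E = klop alpha a m.
Proof.
  induction n as [|n IH]; intros Htr; simpl in Htr;
    inversion Htr as [|? ? ? ? H|? ? ? ? H| | | | | | |]; subst.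
  - destruct (IH H) as (-> & m & Hm & ->).
    split; trivial; exists m; split; trivial; lia.
  - inversion H; subst; split; trivial; exists n; auto.
Qed.

Lemma trans_klop (alpha : Type) {beta : Type} (a : label beta) m n :
  m < n -> trans (klop alpha a n) (act a) (klop alpha a m).
Proof.
  induction 1; simpl; [apply trans_sum_r, trans_prefix | now apply trans_sum_l].
Qed.

Lemma eps_klop {alpha beta : Type} (a : label beta) n (E : process alpha beta) :
  eps (klop alpha a n) E -> E = klop alpha a n.
Proof.
  intros Heps; apply clos_rt_rt1n in Heps; destruct Heps as [|F E Htr _]; trivial.
  apply klop_trans in Htr; now destruct Htr.
Qed.

(** The larger process can move to [klop alpha a m]. Without [tau] steps, the smaller one must
    answer by reaching some [klop alpha a j] with [j < m], which contradicts the induction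
    hypothesis. *)
Lemma klop_lt_not_equiv (alpha : Type) {beta : Type} (a : label beta) m n :
  m < n -> ~ weak_equiv (klop alpha a n) (klop alpha a m).
Proof.
  revert n; induction m as [m IH] using lt_wf_ind; intros n Hmn Heq.
  destruct (weak_equiv_sim _ _ _ _ Heq (trans_klop alpha a _ _ Hmn))
    as (E & (F & G & HF & Htr & HG) & HE).
  apply eps_klop in HF; subst F.
  apply klop_trans in Htr; destruct Htr as (_ & j & Hj & ->).
  apply eps_klop in HG; subst E.
  exact (IH j Hj m Hj HE).
Qed.

(** Each process is weakly equivalent to at most one Klop process, so finitely many processes
    exclude only finitely many indices. *)
Lemma klop_escapes_finite {alpha beta : Type} (a : label beta)
    (A : Ensemble (process alpha beta)) :
  Finite _ A ->
  exists N, forall n E, N <= n -> In _ A E -> ~ weak_equiv E (klop alpha a n).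
Proof.
  induction 1 as [|A _ [N HN] x _].
  - exists 0; intros n E _ [].
  - destruct (classic (exists m, weak_equiv x (klop alpha a m))) as [[m Hm]|Hx].
    + exists (Nat.max N (S m)); intros n E Hn [y Hy | y Hy] Heq.
      * apply (HN n y); trivial; lia.
      * destruct Hy; apply (klop_lt_not_equiv alpha a m n); [lia|].
        apply weak_equiv_trans with x; trivial; now apply weak_equiv_sym.
    + exists N; intros n E Hn [y Hy | y Hy] Heq.
      * now apply (HN n y).
      * destruct Hy; apply Hx; now exists n.
Qed.

(** * Recovering observation congruence from sums *)

Lemma eps_reach {alpha beta : Type} (E F : process alpha beta) :
  eps E F -> reach E F.
Proof.
  induction 1; [apply rt_step; now exists tau | apply rt_refl
    | eapply rt_trans; eassumption].
Qed.

Lemma weak_trans_reach {alpha beta : Type} (E F : process alpha beta) u :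
  weak_trans E u F -> reach E F.
Proof.
  intros (G & H & HG & Htr & HH).
  eapply rt_trans; [apply eps_reach, HG|].
  eapply rt_trans; [apply rt_step; exists u; exact Htr | apply eps_reach, HH].
Qed.

(** The prefixed summand offers no [tau], so any nonempty sequence starts with a step of [q]. *)
Lemma eps_sum_prefix {alpha beta : Type} (q k E : process alpha beta) l :
  eps (sum q (prefix (act l) k)) E ->
  E = sum q (prefix (act l) k) \/ weak_trans q tau E.
Proof.
  intros Heps; apply clos_rt_rt1n in Heps; destruct Heps as [|F E Htr Heps]; auto.
  right; inversion Htr as [|? ? ? ? H|? ? ? ? H| | | | | | |]; subst;
    [|inversion H].
  eapply weak_trans_eps_cons; [exact H | apply clos_rt1n_rt, Heps].
Qed.

Lemma weak_trans_sum_prefix {alpha beta : Type} (q k E : process alpha beta) l l' :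
  weak_trans (sum q (prefix (act l) k)) (act l') E ->
  weak_trans q (act l') E \/ eps k E.
Proof.
  intros (F & G & HF & Htr & HG).
  apply eps_sum_prefix in HF; destruct HF as [-> | (F1 & F2 & H1 & H2 & H3)].
  - inversion Htr as [|? ? ? ? H|? ? ? ? H| | | | | | |]; subst.
    + left; eapply weak_trans_eps_cons; eassumption.
    + inversion H; subst; auto.
  - left; exists F, G; repeat split; trivial.
    eapply rt_trans; [exact H1|]; eapply rt_trans; [apply trans_eps, H2|exact H3].
Qed.

Lemma answer_without_klop {alpha beta : Type} (a : label beta) n
    (p q : process alpha beta)
    (Hp : forall E, reach p E -> ~ weak_equiv E (klop alpha a n)) u p1 :
  weak_equiv (sum p (prefix (act a) (klop alpha a n)))
             (sum q (prefix (act a) (klop alpha a n))) ->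
  trans p u p1 ->
  exists q1, weak_trans q u q1 /\ weak_equiv p1 q1.
Proof.
  intros Heq Htr.
  assert (Hp1 : reach p p1) by (apply rt_step; now exists u).
  destruct (weak_equiv_sim _ _ _ _ Heq (trans_sum_l _ Htr)) as (q1 & Hq1 & H1).
  destruct u as [|l].
  - destruct (eps_sum_prefix _ _ _ _ Hq1) as [-> | Hq]; [exfalso | now exists q1].
    (* Here [q] has idled. The summand still present on its side moves to [klop alpha a n], and the
       state [E] with which [p1] answers is reachable from [p]. *)
    destruct (weak_equiv_sim _ _ _ (klop alpha a n) (weak_equiv_sym _ _ H1)
      (trans_sum_r _ (trans_prefix _ _))) as (E & HE & HkE).
    apply (Hp E); [|now apply weak_equiv_sym].
    eapply rt_trans; [exact Hp1 | exact (weak_trans_reach _ _ _ HE)].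
  - destruct (weak_trans_sum_prefix _ _ _ _ _ Hq1) as [Hq | Hk]; [now exists q1|].
    apply eps_klop in Hk; subst q1; now destruct (Hp p1 Hp1).
Qed.

Theorem theorem16 (alpha beta : Type)
    (alpha_nonempty : inhabited alpha) (beta_nonempty : inhabited beta)
    (p q : process alpha beta)
    (p_finite : finite_state p) (q_finite : finite_state q) :
  obs_congr p q <->
  forall r : process alpha beta, weak_equiv (sum p r) (sum q r).
Proof.
  split; [intros H r; now apply obs_congr_weak_equiv_sum | intros H u].
  destruct beta_nonempty as [b].
  destruct (klop_escapes_finite (name b) _ p_finite) as [N HN].
  destruct (klop_escapes_finite (name b) _ q_finite) as [M HM].
  (* The maximum exceeds both bounds, so a single [r] serves the moves of [p] and those of [q]. *)
  specialize (H (prefix (act (name b)) (klop alpha (name b) (Nat.max N M)))).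
  split.
  - intros p1; apply (answer_without_klop (name b) (Nat.max N M)); trivial.
    intros E HE; apply HN; trivial; lia.
  - intros q1 Hq1.
    destruct (answer_without_klop (name b) (Nat.max N M) q p) with (3 := Hq1)
      as (p1 & Hp1 & H1).
    + intros E HE; apply HM; trivial; lia.
    + now apply weak_equiv_sym.
    + exists p1; split; trivial; now apply weak_equiv_sym.
Qed.
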